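(* Let $n$ be an integer with $5\le n<\infty$, and let $A=\mathrm{IDD}(K^0_n,-1,-1)$ be the complex algebra with basis $e_0,e_1,\ldots,e_n$ and bilinear multiplication $e_i\diamond e_j=\frac{1}{(i+1)(j+1)}e_{i+j+2}$ if $i+j\le n-2$, and $e_i\diamond e_j=0$ otherwise. Then the space of derivations of $A$ is $$\mathfrak{Der}(A)=\langle\varphi,\ \phi_i,\ \psi_j : 0\le i\le 4,\ 0\le j\le 2\rangle,$$ where these linear maps are given on the basis (all values not listed being zero) by - $\varphi(e_i)=(i+2)e_i$ for $0\le i\le n$; - $\phi_4(e_0)=4(n-1)(n-3)e_{n-4}$, $\phi_4(e_1)=(n-2)(n+5)e_{n-3}$, $\phi_4(e_2)=8(n-1)e_{n-2}$, $\phi_4(e_3)=6(n+1)e_{n-1}$, $\phi_4(e_4)=4(n+5)e_n$; - $\phi_3(e_0)=(n-2)e_{n-3}$, $\phi_3(e_2)=2e_{n-1}$, $\phi_3(e_3)=e_n$; - $\phi_2(e_0)=(n-1)e_{n-2}$, $\phi_2(e_2)=2e_n$; - $\phi_1(e_0)=e_{n-1}$; - $\phi_0(e_0)=e_n$; - $\psi_2(e_1)=(n-1)e_{n-2}$, $\psi_2(e_3)=2e_n$; - $\psi_1(e_1)=e_{n-1}$; - $\psi_0(e_1)=e_n$.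
   Context: A derivation of an algebra $(A,\diamond)$ is a linear map $D:A\to A$ with $D(a\diamond b)=D(a)\diamond b+a\diamond D(b)$ for all $a,b\in A$. $\langle S\rangle$ denotes the linear span of $S$ over $\mathbb C$. *)

(* Defs.v *)
From HB Require Import structures.
From mathcomp Require Import all_boot all_order all_algebra.
From mathcomp Require Import complex reals.

Set Implicit Arguments.
Unset Strict Implicit.
Unset Printing Implicit Defensive.

Import GRing.Theory.
Local Open Scope ring_scope.

(* MathComp has no structure for non-associative algebras, so an algebra is a
   vector space together with a multiplication [mul]. *)
Definition is_derivation (F : fieldType) (V : vectType F) (mul : V -> V -> V)
    (D : 'End(V)) : Prop :=
  forall a b : V, D (mul a b) = mul (D a) b + mul a (D b).

Section IDD.

Variables (C : fieldType) (n : nat).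

(* Underlying space: coordinate vectors in the basis e_0, ..., e_n. *)
Local Notation A := 'rV[C]_(n.+1).

(* The basis vector e_k; meaningful for k <= n only ([inord] sends any larger k
   to 0), hence every use below keeps its index in range. *)
Definition e (k : nat) : A := delta_mx 0 (inord k).

(* The product of basis vectors; [i + j + 2 <= n] is [i + j <= n - 2] without
   truncated subtraction. *)
Definition mul_basis (i j : nat) : A :=
  if (i + j + 2 <= n)%N then
    (1 / ((i%:R + 1) * (j%:R + 1))) *: e (i + j + 2)
  else 0.

Definition IDD_mul (x y : A) : A :=
  \sum_(i < n.+1) \sum_(j < n.+1) (x 0 i * y 0 j) *: mul_basis i j.

(* The endomorphism sending e_i to [f i] for 0 <= i <= n: x is mapped to the
   sum of the x_i *: f i, which is the row vector x times the matrix whose i-th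
   row is [f i]. *)
Definition lin_on_basis (f : nat -> A) : 'End(A) :=
  linfun (mulmxr (\matrix_(i < n.+1) f i)).

Definition varphi : 'End(A) := lin_on_basis (fun i => (i%:R + 2) *: e i).

Definition phi4 : 'End(A) := lin_on_basis (fun i => match i with
  | 0 => (4 * (n%:R - 1) * (n%:R - 3)) *: e (n - 4)
  | 1 => ((n%:R - 2) * (n%:R + 5)) *: e (n - 3)
  | 2 => (8 * (n%:R - 1)) *: e (n - 2)
  | 3 => (6 * (n%:R + 1)) *: e (n - 1)
  | 4 => (4 * (n%:R + 5)) *: e n
  | _ => 0
  end).

Definition phi3 : 'End(A) := lin_on_basis (fun i => match i with
  | 0 => (n%:R - 2) *: e (n - 3)
  | 2 => 2 *: e (n - 1)
  | 3 => e n
  | _ => 0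
  end).

Definition phi2 : 'End(A) := lin_on_basis (fun i => match i with
  | 0 => (n%:R - 1) *: e (n - 2)
  | 2 => 2 *: e n
  | _ => 0
  end).

Definition phi1 : 'End(A) := lin_on_basis (fun i => match i with
  | 0 => e (n - 1)
  | _ => 0
  end).

Definition phi0 : 'End(A) := lin_on_basis (fun i => match i with
  | 0 => e n
  | _ => 0
  end).

Definition psi2 : 'End(A) := lin_on_basis (fun i => match i with
  | 1 => (n%:R - 1) *: e (n - 2)
  | 3 => 2 *: e n
  | _ => 0
  end).

Definition psi1 : 'End(A) := lin_on_basis (fun i => match i with
  | 1 => e (n - 1)
  | _ => 0
  end).

Definition psi0 : 'End(A) := lin_on_basis (fun i => match i with
  | 1 => e n
  | _ => 0
  end).

End IDD.

(* Main.v *)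
Require Import Defs.
From HB Require Import structures.
From mathcomp Require Import all_boot all_order all_algebra.
From mathcomp Require Import complex reals.
From mathcomp Require Import ring zify.

Set Implicit Arguments.
Unset Strict Implicit.
Unset Printing Implicit Defensive.

Import GRing.Theory.
Local Open Scope ring_scope.

(** Why the theorem is true.  If I denotes the linear map e_i |-> e_{i+1}/(i+1)
    (integration of t^i), the product is I(a)I(b), up to truncation; giving
    e_i the degree i + 2 makes it a graded product.  Two consequences carry the
    proof.

    Grading.  The matrix entries of a linear map D split according to the shift
    s = k - i between the source e_i and the target e_k, and the Leibniz rule
    splits accordingly.  Each generator in the theorem has a single shift, so
    that it is a derivation as soon as its coefficients satisfy one scalar
    equation for each pair (i, j) with i + j + 2 + s <= n
    ([derivation_of_shift]).  For s >= n - 4 only few pairs are left, and these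
    equations are checked by computation.

    Generation.  Up to scalars e_{i+2} is e_0 e_i, so e_0 and e_1 generate the
    algebra, and a derivation D is determined by D e_0 and D e_1.  These are in
    turn constrained by the two ways of reaching e_4 and e_5 from products:
    4 e_1 e_1 = 3 e_0 e_2 and 4 e_0 e_3 = 6 e_1 e_2.  Write G_i for the
    normalised entry of D in row i and shift s ([shift_coef]).  The first
    relation gives 2(s+3) G_1 = (s+9) G_0 when s <= n - 4
    ([shift_coef01]); together with it the second gives s(s+1) G_0 = 0 when
    s <= n - 5 ([shift_coef0_eq0]).  So the nonnegative shifts s <= n - 5
    contribute nothing apart from s = 0, where G_1 is determined by G_0, and
    s = n - 4 leaves only one parameter.  The only possible negative shift in
    D e_0 and D e_1 sends e_1 to e_0, and it is excluded by the relation in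
    degree e_4 ([ecoef_e1_0]).

    Hence a derivation is zero once nine of its coordinates vanish: those of
    D e_0 at 0, n-4, ..., n and of D e_1 at n-2, n-1, n
    ([derivation_eq0_coef]).  The nine generators realise every choice of
    these coordinates ([comb_coordinates]), so subtracting a suitable
    combination from a given derivation leaves zero. *)

(** * Coordinates and bilinearity *)

Section Algebra.

Variables (C : numFieldType) (n : nat).

Local Notation A := 'rV[C]_(n.+1).
Local Notation "x ⋄ y" := (@IDD_mul C n x y) (at level 40, left associativity).
Local Notation e := (@e C n).
Local Notation derivation := (is_derivation (@IDD_mul C n)).

Definition ecoef (x : A) (k : nat) : C := x 0 (inord k).

Lemma natr1_neq0 (k : nat) : (k%:R + 1 : C) != 0.
Proof. by rewrite natr1 Num.Theory.pnatr_eq0. Qed.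

Lemma ecoefD x y k : ecoef (x + y) k = ecoef x k + ecoef y k.
Proof. by rewrite /ecoef mxE. Qed.

Lemma ecoefN x k : ecoef (- x) k = - ecoef x k.
Proof. by rewrite /ecoef mxE. Qed.

Lemma ecoefZ a x k : ecoef (a *: x) k = a * ecoef x k.
Proof. by rewrite /ecoef mxE. Qed.

Lemma ecoef0 k : ecoef 0 k = 0.
Proof. by rewrite /ecoef mxE. Qed.

Lemma ecoef_e (i k : nat) :
  (i <= n)%N -> (k <= n)%N -> ecoef (e i) k = (i == k)%:R.
Proof.
move=> hi hk; rewrite /ecoef mxE eqxx /=; congr (nat_of_bool _)%:R.
by rewrite -(inj_eq val_inj) /= !inordK // eq_sym.
Qed.

Lemma ecoef_eq0 (x : A) : (forall k, (k <= n)%N -> ecoef x k = 0) -> x = 0.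
Proof.
by move=> h; apply/rowP => i; rewrite mxE -(h i (leq_ord i)) /ecoef inord_val.
Qed.

Lemma row_e_sum (x : A) : x = \sum_(i < n.+1) x 0 i *: e i.
Proof.
rewrite {1}(row_sum_delta x); apply: eq_bigr => i _.
by rewrite /Defs.e inord_val.
Qed.

Lemma ecoef_mul_basis (i j l : nat) : (l <= n)%N ->
  ecoef (mul_basis C n i j) l =
  (i + j + 2 == l)%:R / ((i%:R + 1) * (j%:R + 1)).
Proof.
move=> hl; rewrite /mul_basis; case: leqP => h.
  by rewrite ecoefZ ecoef_e // div1r mulrC.
by rewrite ecoef0 gtn_eqF ?mul0r //; apply: leq_ltn_trans h.
Qed.

Lemma IDD_mulDl x y z : (x + y) ⋄ z = x ⋄ z + y ⋄ z.
Proof.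
rewrite /IDD_mul -big_split; apply: eq_bigr => i _ /=.
rewrite -big_split; apply: eq_bigr => j _ /=.
by rewrite mxE mulrDl scalerDl.
Qed.

Lemma IDD_mulZl a x z : (a *: x) ⋄ z = a *: (x ⋄ z).
Proof.
rewrite /IDD_mul scaler_sumr; apply: eq_bigr => i _ /=.
rewrite scaler_sumr; apply: eq_bigr => j _ /=.
by rewrite mxE scalerA mulrA.
Qed.

Lemma IDD_mulC x y : x ⋄ y = y ⋄ x.
Proof.
rewrite /IDD_mul exchange_big /=; apply: eq_bigr => i _; apply: eq_bigr => j _.
by rewrite mulrC /mul_basis (addnC i j) (mulrC (i%:R + 1)).
Qed.

Lemma IDD_mulDr x y z : z ⋄ (x + y) = z ⋄ x + z ⋄ y.
Proof. by rewrite IDD_mulC IDD_mulDl !(IDD_mulC z). Qed.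

Lemma IDD_mulZr a x z : z ⋄ (a *: x) = a *: (z ⋄ x).
Proof. by rewrite IDD_mulC IDD_mulZl (IDD_mulC z). Qed.

Lemma IDD_mul0l z : 0 ⋄ z = 0.
Proof. by have := IDD_mulZl 0 0 z; rewrite !scale0r. Qed.

Lemma IDD_mul0r z : z ⋄ 0 = 0.
Proof. by rewrite IDD_mulC IDD_mul0l. Qed.

Lemma IDD_mul_suml (I : finType) (F : I -> A) z :
  (\sum_i F i) ⋄ z = \sum_i F i ⋄ z.
Proof.
by elim/big_rec2: _ => [|i y x _ <-]; rewrite ?IDD_mulDl ?IDD_mul0l.
Qed.

Lemma IDD_mul_sumr (I : finType) (F : I -> A) z :
  z ⋄ (\sum_i F i) = \sum_i z ⋄ F i.
Proof.
by rewrite IDD_mulC IDD_mul_suml; apply: eq_bigr => i _; rewrite IDD_mulC.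
Qed.

Lemma mul_e (i j : nat) :
  (i <= n)%N -> (j <= n)%N -> e i ⋄ e j = mul_basis C n i j.
Proof.
move=> hi hj; rewrite /IDD_mul (bigD1 (inord i)) //=.
rewrite (bigD1 (inord j)) //= big1 => [|k hk]; last first.
  by rewrite /Defs.e !mxE (negPf hk) andbF mulr0 scale0r.
rewrite big1 => [|k hk]; last first.
  by rewrite big1 // => l _; rewrite /Defs.e !mxE (negPf hk) andbF mul0r scale0r.
by rewrite /Defs.e !mxE !eqxx mulr1 scale1r !addr0 !inordK.
Qed.

(** The formula by which the Leibniz rule is turned into scalar equations:
    multiplication by e_j shifts coordinates by j + 2. *)
Lemma ecoef_mul_er (x : A) (j l : nat) : (j <= n)%N -> (l <= n)%N ->
  ecoef (x ⋄ e j) l =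
  if (j + 2 <= l)%N then ecoef x (l - j - 2) / (((l - j - 2)%:R + 1) * (j%:R + 1))
  else 0.
Proof.
move=> hj hl; rewrite {1}(row_e_sum x) IDD_mul_suml /ecoef summxE.
transitivity (\sum_(i < n.+1) x 0 i * ecoef (mul_basis C n i j) l).
  by apply: eq_bigr => i _; rewrite IDD_mulZl mxE mul_e ?leq_ord.
case: ifP => h; last first.
  rewrite big1 // => i _; rewrite ecoef_mul_basis //.
  by case: eqP => [|_]; [lia | rewrite mul0r mulr0].
rewrite (bigD1 (inord (l - j - 2))) //= ecoef_mul_basis // inordK; last lia.
have -> : (l - j - 2 + j + 2 == l)%N by lia.
rewrite big1 ?addr0 ?div1r // => i hi; rewrite ecoef_mul_basis //.
case: eqP => [hl'|_]; last by rewrite mul0r mulr0.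
by case/eqP: hi; apply/val_inj; rewrite /= inordK; lia.
Qed.

Lemma e_mul (i j : nat) : (i + j + 2 <= n)%N ->
  e (i + j + 2) = ((i%:R + 1) * (j%:R + 1)) *: (e i ⋄ e j).
Proof.
move=> h; rewrite mul_e; [|lia|lia].
by rewrite /mul_basis h scalerA div1r divff ?scale1r // mulf_neq0 ?natr1_neq0.
Qed.

(** * Generalities on derivations *)

Lemma derivationD D1 D2 :
  derivation D1 -> derivation D2 -> derivation (D1 + D2).
Proof.
move=> h1 h2 a b; rewrite !add_lfunE h1 h2 IDD_mulDl IDD_mulDr.
by rewrite addrACA.
Qed.

Lemma derivationZ c D : derivation D -> derivation (c *: D).
Proof. by move=> h a b; rewrite !scale_lfunE h scalerDr IDD_mulZl IDD_mulZr. Qed.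

Lemma derivation0 : derivation 0.
Proof. by move=> a b; rewrite !zero_lfunE IDD_mul0l IDD_mul0r addr0. Qed.

Lemma derivation_span (X : seq 'End(A)) (D : 'End(A)) :
  (forall E, E \in X -> derivation E) -> D \in <<X>>%VS -> derivation D.
Proof.
move=> hX; rewrite -[X]in_tupleE => /coord_span ->.
apply: big_ind => [||i _]; [exact: derivation0 | exact: derivationD |].
by apply/derivationZ/hX/mem_nth.
Qed.

Lemma lin_on_basisE (f : nat -> A) (i : nat) :
  (i <= n)%N -> lin_on_basis f (e i) = f i.
Proof. by move=> hi; rewrite lfunE /= -rowE rowK inordK. Qed.

Lemma derivation_on_basis (D : 'End(A)) :
  (forall i j, (i <= n)%N -> (j <= n)%N ->
     D (e i ⋄ e j) = D (e i) ⋄ e j + e i ⋄ D (e j)) -> derivation D.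
Proof.
move=> h a b.
have step i : (i <= n)%N -> D (e i ⋄ b) = D (e i) ⋄ b + e i ⋄ D b.
  move=> hi; rewrite (row_e_sum b) !IDD_mul_sumr 2!linear_sum IDD_mul_sumr.
  rewrite -big_split.
  apply: eq_bigr => j _ /=.
  by rewrite IDD_mulZr !linearZ /= h ?leq_ord // !IDD_mulZr -scalerDr.
rewrite (row_e_sum a) !IDD_mul_suml 2!linear_sum IDD_mul_suml -big_split.
apply: eq_bigr => i _ /=.
by rewrite IDD_mulZl !linearZ /= step ?leq_ord // !IDD_mulZl -scalerDr.
Qed.

(** For a map e_i |-> c_i e_{i+s} the Leibniz rule on (e_i, e_j) compares
    multiples of the single vector e_{i+j+2+s}.  When that index exceeds n all
    three terms vanish; otherwise the hypothesis on c is the comparison of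
    coefficients, with denominators cleared. *)
Lemma derivation_of_shift (D : 'End(A)) (s : nat) (c : nat -> C) :
  (forall i, (i <= n)%N ->
     D (e i) = if (i + s <= n)%N then c i *: e (i + s) else 0) ->
  (forall i j, (i + j + 2 + s <= n)%N ->
     c (i + j + 2)%N * ((i + s)%:R + 1) * ((j + s)%:R + 1) =
     c i * (i%:R + 1) * ((j + s)%:R + 1) +
     c j * (j%:R + 1) * ((i + s)%:R + 1)) ->
  derivation D.
Proof.
move=> hD hc.
have De_mul i j : (i <= n)%N -> (j <= n)%N ->
    D (e i) ⋄ e j = if (i + j + 2 + s <= n)%N
      then (c i / (((i + s)%:R + 1) * (j%:R + 1))) *: e (i + j + 2 + s) else 0.
  move=> hi hj; rewrite hD //; case: leqP => his; last first.
    by rewrite IDD_mul0l; case: leqP => //; lia.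
  rewrite IDD_mulZl mul_e // /mul_basis.
  have -> : (i + s + j + 2 = i + j + 2 + s)%N by lia.
  by case: leqP; rewrite ?scaler0 // scalerA div1r.
apply: derivation_on_basis => i j hi hj.
rewrite (IDD_mulC (e i) (D _)) !De_mul // mul_e // /mul_basis (addnC j i).
case: leqP => hij; last first.
  by rewrite linear0; case: leqP => [|_]; [lia | rewrite addr0].
rewrite linearZ /= hD //; case: leqP => hijs; last by rewrite scaler0 addr0.
rewrite scalerA -scalerDl; congr (_ *: _).
have := hc i j hijs; move: (natr1_neq0 (j + s)) (natr1_neq0 (i + s)).
move: (natr1_neq0 j) (natr1_neq0 i).
move: (i%:R + 1) (j%:R + 1) ((i + s)%:R + 1) ((j + s)%:R + 1)
  => I J I' J' hJ hI hJ' hI' h.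
apply: (mulfI (mulf_neq0 (mulf_neq0 hI hJ) (mulf_neq0 hI' hJ'))).
transitivity (c (i + j + 2)%N * I' * J'); first by field; rewrite hI hJ.
by rewrite h; field; rewrite hI hJ hI' hJ'.
Qed.

(** * The nine generators are derivations *)

Lemma varphi_derivation : derivation (varphi C n).
Proof.
apply: (@derivation_of_shift _ 0 (fun i => i%:R + 2)) => [i hi|i j _].
  by rewrite lin_on_basisE // addn0 hi.
by rewrite !addn0 !natrD; ring.
Qed.

Ltac shift_table :=
  case=> [|[|[|[|[|i]]]]] hi; rewrite lin_on_basisE //=;
  case: leqP => // h; first [lia | rewrite ?scale0r ?scale1r //;
  first [congr (_ *: e _); lia | congr (e _); lia]].

(* The shift is at least n - 4 for the maps treated with this tactic, so that
   only pairs with i + j <= 2 give an equation. *)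
Ltac shift_equations :=
  case=> [|[|[|i]]] [|[|[|j]]] h; first [lia |
  rewrite ?add0n ?addn0 /= ?natrD ?natrB //; first [lia | ring]].

Lemma phi4_derivation : (4 <= n)%N -> derivation (phi4 C n).
Proof.
move=> hn; apply: (@derivation_of_shift _ (n - 4) (fun i => match i with
  | 0 => 4 * (n%:R - 1) * (n%:R - 3)
  | 1 => (n%:R - 2) * (n%:R + 5)
  | 2 => 8 * (n%:R - 1)
  | 3 => 6 * (n%:R + 1)
  | 4 => 4 * (n%:R + 5)
  | _ => 0
  end)).
  shift_table.
shift_equations.
Qed.

Lemma phi3_derivation : (3 <= n)%N -> derivation (phi3 C n).
Proof.
move=> hn; apply: (@derivation_of_shift _ (n - 3) (fun i => match i with
  | 0 => n%:R - 2 | 2 => 2 | 3 => 1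
  | _ => 0
  end)).
  shift_table.
shift_equations.
Qed.

Lemma phi2_derivation : (2 <= n)%N -> derivation (phi2 C n).
Proof.
move=> hn; apply: (@derivation_of_shift _ (n - 2) (fun i => match i with
  | 0 => n%:R - 1 | 2 => 2
  | _ => 0
  end)).
  shift_table.
shift_equations.
Qed.

Lemma phi1_derivation : (1 <= n)%N -> derivation (phi1 C n).
Proof.
move=> hn; apply: (@derivation_of_shift _ (n - 1) (fun i => match i with
  | 0 => 1
  | _ => 0
  end)).
  shift_table.
shift_equations.
Qed.

Lemma phi0_derivation : derivation (phi0 C n).
Proof.
apply: (@derivation_of_shift _ n (fun i => match i with
  | 0 => 1
  | _ => 0
  end)).
  shift_table.
shift_equations.
Qed.

Lemma psi2_derivation : (3 <= n)%N -> derivation (psi2 C n).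
Proof.
move=> hn; apply: (@derivation_of_shift _ (n - 3) (fun i => match i with
  | 1 => n%:R - 1 | 3 => 2
  | _ => 0
  end)).
  shift_table.
shift_equations.
Qed.

Lemma psi1_derivation : (2 <= n)%N -> derivation (psi1 C n).
Proof.
move=> hn; apply: (@derivation_of_shift _ (n - 2) (fun i => match i with
  | 1 => 1
  | _ => 0
  end)).
  shift_table.
shift_equations.
Qed.

Lemma psi0_derivation : (1 <= n)%N -> derivation (psi0 C n).
Proof.
move=> hn; apply: (@derivation_of_shift _ (n - 1) (fun i => match i with
  | 1 => 1
  | _ => 0
  end)).
  shift_table.
shift_equations.
Qed.

(** * Nine coordinates determine a derivation *)

Section Rigidity.

Variable D : 'End(A).
Hypothesis derD : derivation D.

Lemma derivation_e (i j : nat) : (i + j + 2 <= n)%N ->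
  D (e (i + j + 2)) =
  ((i%:R + 1) * (j%:R + 1)) *: (D (e i) ⋄ e j + D (e j) ⋄ e i).
Proof. by move=> h; rewrite e_mul // linearZ /= derD (IDD_mulC (e i)). Qed.

(** Entry (i, i + s) of the matrix of D in the basis (i + 1) e_i.  In that
    basis the structure constants depend on i + j only, and the Leibniz rule
    takes the form [shift_coef_eq], whose right-hand side is a sum of a
    function of i and the same function of j. *)
Definition shift_coef (s i : nat) : C :=
  (i%:R + 1) / ((i + s)%:R + 1) * ecoef (D (e i)) (i + s).

Lemma shift_coef_eq (s i j : nat) : (i + j + 2 + s <= n)%N ->
  ((i + j + 2 + s)%:R + 1) * shift_coef s (i + j + 2) =
  ((i + j + 2)%:R + 1) * (shift_coef s i + shift_coef s j).
Proof.
move=> h; rewrite /shift_coef derivation_e; last lia.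
rewrite ecoefZ ecoefD !ecoef_mul_er; try lia.
rewrite !ifT; try lia.
have -> : (i + j + 2 + s - j - 2 = i + s)%N by lia.
have -> : (i + j + 2 + s - i - 2 = j + s)%N by lia.
move: (natr1_neq0 (i + j + 2 + s)) (natr1_neq0 (i + s)) (natr1_neq0 (j + s)).
move: (natr1_neq0 i) (natr1_neq0 j).
move: (_%:R + 1) (_%:R + 1) (_%:R + 1) (_%:R + 1) (_%:R + 1) (_%:R + 1)
  => I0 I1 I2 I3 I4 I5.
move=> hi hj hijs his hjs.
by field; rewrite hi hj his hjs hijs.
Qed.

(** Compares the expressions of D e_4 obtained from e_1 e_1 and e_0 e_2,
    where D e_2 is known from e_2 = e_0 e_0. *)
Lemma shift_coef01 (s : nat) : (s + 4 <= n)%N ->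
  2 * (s%:R + 3) * shift_coef s 1 = (s%:R + 9) * shift_coef s 0.
Proof.
move=> h.
have E2 := @shift_coef_eq s 0 0 ltac:(lia).
have E4 := @shift_coef_eq s 1 1 ltac:(lia).
have E4' := @shift_coef_eq s 0 2 ltac:(lia).
move: E4; rewrite [LHS]E4' => /(mulfI (natr1_neq0 _)) /= E4.
have {}E2 : (s%:R + 3) * shift_coef s 2 = 6 * shift_coef s 0.
  move: E2; rewrite !add0n natrD => E2.
  by transitivity ((2 + s%:R + 1) * shift_coef s 2); [ring | rewrite E2; ring].
transitivity ((s%:R + 3) * (shift_coef s 1 + shift_coef s 1)); first by ring.
by rewrite -E4 mulrDr E2; ring.
Qed.

(** Compares the expressions of D e_5 obtained from e_0 e_3 and e_1 e_2. After
    elimination of the entries of rows 1, 2, 3 there remains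
    s (s + 1) G_0 = 0, which is why shift 0 escapes. *)
Lemma shift_coef0_eq0 (s : nat) :
  (0 < s)%N -> (s + 5 <= n)%N -> shift_coef s 0 = 0.
Proof.
move=> s0 h.
have E1 := @shift_coef01 s ltac:(lia).
have E2 := @shift_coef_eq s 0 0 ltac:(lia).
have E3 := @shift_coef_eq s 0 1 ltac:(lia).
have E5 := @shift_coef_eq s 0 3 ltac:(lia).
have E5' := @shift_coef_eq s 1 2 ltac:(lia).
move: E5; rewrite [LHS]E5' => /(mulfI (natr1_neq0 _)) /= E5.
move: E2 E3; rewrite !add0n !natrD => E2 E3.
have sn0 : (s%:R : C) != 0 by rewrite Num.Theory.pnatr_eq0; lia.
apply: (mulfI (mulf_neq0 sn0 (natr1_neq0 s))); rewrite mulr0.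
set G0 := shift_coef s 0 in E1 E2 E3 E5 *.
set G1 := shift_coef s 1 in E1 E3 E5.
set G2 := shift_coef s 2 in E2 E5.
set G3 := shift_coef s 3 in E3 E5.
(* The combination of the four relations that eliminates G1, G2 and G3. *)
transitivity (2 * (s%:R + 3) * (s%:R + 4) * ((G0 + G3) - (G1 + G2))
  - 2 * (s%:R + 3) * ((1 + 2 + s%:R + 1) * G3 - (1 + 2 + 1) * (G0 + G1))
  + 2 * (s%:R + 4) * ((2 + s%:R + 1) * G2 - (2 + 1) * (G0 + G0))
  + s%:R * (2 * (s%:R + 3) * G1 - (s%:R + 9) * G0)); first by ring.
by rewrite E1 E2 E3 E5; ring.
Qed.

Lemma ecoef_of_shift_coef_eq0 (s i : nat) :
  shift_coef s i = 0 -> ecoef (D (e i)) (i + s) = 0.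
Proof.
move/eqP; rewrite !mulf_eq0 invr_eq0 !(negPf (natr1_neq0 _)) /=.
by move/eqP.
Qed.

(** The shift -1 analogue of [shift_coef01]: on the coordinate of index 3,
    e_0 e_2 contributes nothing to D e_4, while e_1 e_1 contributes a nonzero
    multiple of this entry. *)
Lemma ecoef_e1_0 : (4 <= n)%N -> ecoef (D (e 1)) 0 = 0.
Proof.
move=> hn.
have := congr1 (ecoef^~ 3%N) (@derivation_e 1 1 ltac:(lia)).
rewrite (@derivation_e 0 2) //= (@derivation_e 0 0) ?ecoefZ ?IDD_mulZl; last lia.
rewrite !(ecoefZ, ecoefD) !ecoef_mul_er //=; try lia.
rewrite /subn /=.
rewrite ecoefD !ecoef_mul_er //=; try lia.
move: (ecoef _ 0) => x hx.
have n4 : 4 != 0 :> C by rewrite Num.Theory.pnatr_eq0.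
apply: (mulfI n4); rewrite mulr0.
transitivity ((0 + 1) * (2 + 1) *
  (0 + (0 + 1) * (0 + 1) * ((0 + 0 : C) / ((1 + 1) * (0 + 1))))); last by ring.
by rewrite hx; field.
Qed.

(** The vectors e_0 and e_1 generate the algebra, because e_{k+2} is a multiple
    of e_0 e_k. *)
Lemma derivation_eq0_generators : D (e 0) = 0 -> D (e 1) = 0 -> D = 0.
Proof.
move=> D0 D1.
have De k : (k <= n)%N -> D (e k) = 0.
  elim/ltn_ind: k => -[|[|k]] // IH hk.
  have -> : k.+2 = (0 + k + 2)%N by lia.
  by rewrite derivation_e ?D0 ?(IH k) ?IDD_mul0l ?addr0 ?scaler0 //; lia.
apply/lfunP => x; rewrite (row_e_sum x) linear_sum big1 ?zero_lfunE // => i _.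
by rewrite linearZ /= De ?scaler0 ?leq_ord.
Qed.

Lemma derivation_eq0_coef : (5 <= n)%N ->
  ecoef (D (e 0)) 0 = 0 ->
  (forall k, (n - 4 <= k <= n)%N -> ecoef (D (e 0)) k = 0) ->
  (forall k, (n - 2 <= k <= n)%N -> ecoef (D (e 1)) k = 0) ->
  D = 0.
Proof.
move=> hn h00 h0 h1.
have D0 : D (e 0) = 0.
  apply: ecoef_eq0 => -[|k] hk //; case: (leqP (n - 4) k.+1) => hk'.
    by rewrite h0 // hk'.
  by apply/(@ecoef_of_shift_coef_eq0 k.+1 0)/shift_coef0_eq0; lia.
apply: derivation_eq0_generators => //; apply: ecoef_eq0 => -[|k] hk.
  by apply: ecoef_e1_0; lia.
case: (leqP (n - 2) k.+1) => hk'; first by rewrite h1 // hk'.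
apply: (@ecoef_of_shift_coef_eq0 k 1).
have k3 : 2 * (k%:R + 3) != 0 :> C.
  by rewrite -natrD mulf_neq0 ?Num.Theory.pnatr_eq0 //; lia.
apply: (mulfI k3); rewrite shift_coef01; last lia.
by rewrite {1}/shift_coef D0 ecoef0 !mulr0.
Qed.

End Rigidity.

(** * Spanning *)

Definition generators : seq 'End(A) :=
  [:: varphi C n; phi0 C n; phi1 C n; phi2 C n; phi3 C n; phi4 C n;
      psi0 C n; psi1 C n; psi2 C n].

Lemma generators_derivation (F : 'End(A)) :
  (5 <= n)%N -> F \in generators -> derivation F.
Proof.
move=> hn; rewrite !inE.
do 8?[case/orP] => /eqP ->; [exact: varphi_derivation |
  exact: phi0_derivation | apply: phi1_derivation | apply: phi2_derivation |
  apply: phi3_derivation | apply: phi4_derivation | apply: psi0_derivation |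
  apply: psi1_derivation | apply: psi2_derivation]; lia.
Qed.

Section Combination.

Variables a a0 a1 a2 a3 a4 b0 b1 b2 : C.

Definition comb : 'End(A) :=
  a *: varphi C n + a0 *: phi0 C n + a1 *: phi1 C n + a2 *: phi2 C n +
  a3 *: phi3 C n + a4 *: phi4 C n + b0 *: psi0 C n + b1 *: psi1 C n +
  b2 *: psi2 C n.

Lemma comb_span : comb \in <<generators>>%VS.
Proof.
rewrite /comb /generators.
by do 8?[apply: memvD]; apply: memvZ; apply: memv_span; rewrite !inE eqxx ?orbT.
Qed.

Lemma comb_e0 : comb (e 0) =
  (2 * a) *: e 0 + a0 *: e n + a1 *: e (n - 1) + (a2 * (n%:R - 1)) *: e (n - 2) +
  (a3 * (n%:R - 2)) *: e (n - 3) + (a4 * (4 * (n%:R - 1) * (n%:R - 3))) *: e (n - 4).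
Proof.
rewrite !add_lfunE !scale_lfunE !lin_on_basisE //=.
by rewrite !scaler0 !addr0 add0r !scalerA (mulrC a).
Qed.

Lemma comb_e1 : (1 <= n)%N -> comb (e 1) =
  (3 * a) *: e 1 + (a4 * ((n%:R - 2) * (n%:R + 5))) *: e (n - 3) +
  b0 *: e n + b1 *: e (n - 1) + (b2 * (n%:R - 1)) *: e (n - 2).
Proof.
move=> hn; rewrite !add_lfunE !scale_lfunE !lin_on_basisE //=.
by rewrite !scaler0 !addr0 !scalerA (_ : a * (1 + 2) = 3 * a) //; ring.
Qed.

End Combination.

Ltac decide_eqs := repeat match goal with |- context[(?p == ?q)%N] =>
  first [ have -> : (p == q)%N = true by lia
        | have -> : (p == q)%N = false by lia ] end; rewrite ?mulr1n ?mulr0n.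

Ltac ecoef_comb :=
  rewrite !(ecoefD, ecoefZ) !ecoef_e; try lia; decide_eqs.

(** The coordinates prescribed here are those which determine a derivation
    by [derivation_eq0_coef]. *)
Lemma comb_coordinates (x y : nat -> C) : (5 <= n)%N -> exists F,
  [/\ F \in <<generators>>%VS,
      ecoef (F (e 0)) 0 = x 0,
      forall k, (n - 4 <= k <= n)%N -> ecoef (F (e 0)) k = x k &
      forall k, (n - 2 <= k <= n)%N -> ecoef (F (e 1)) k = y k].
Proof.
move=> hn.
have natrB_neq0 k : (k < n)%N -> n%:R - k%:R != 0 :> C.
  by move=> hk; rewrite -natrB 1?ltnW // Num.Theory.pnatr_eq0; lia.
have n1 : n%:R - 1 != 0 :> C by apply: (natrB_neq0 1); lia.
have n2 : n%:R - 2 != 0 :> C by apply: (natrB_neq0 2); lia.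
have n3 : n%:R - 3 != 0 :> C by apply: (natrB_neq0 3); lia.
(* The system is diagonal: each prescribed coordinate is hit by exactly one
   generator, with the coefficient that is divided out here. *)
exists (comb (x 0 / 2) (x n) (x (n - 1)%N) (x (n - 2)%N / (n%:R - 1))
  (x (n - 3)%N / (n%:R - 2)) (x (n - 4)%N / (4 * (n%:R - 1) * (n%:R - 3)))
  (y n) (y (n - 1)%N) (y (n - 2)%N / (n%:R - 1))).
split=> [||k hk|k hk]; first exact: comb_span.
- by rewrite comb_e0; ecoef_comb; field; rewrite ?n1 ?n2 ?n3.
- have : (k = n \/ k = n - 1 \/ k = n - 2 \/ k = n - 3 \/ k = n - 4)%N by lia.
  by case=> [|[|[|[|]]]] ->; rewrite comb_e0; ecoef_comb; field; rewrite ?n1 ?n2 ?n3.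
- have : (k = n \/ k = n - 1 \/ k = n - 2)%N by lia.
  by case=> [|[|]] ->; rewrite comb_e1; try lia; ecoef_comb; field; rewrite ?n1 ?n2 ?n3.
Qed.

Lemma derivation_spanP (hn : (5 <= n)%N) (D : 'End(A)) :
  derivation D <-> D \in <<generators>>%VS.
Proof.
have der_span F : F \in <<generators>>%VS -> derivation F.
  by apply: derivation_span => E; apply: generators_derivation.
split=> [derD|]; last exact: der_span.
have [F [FX F00 F0 F1]] := comb_coordinates (ecoef (D (e 0))) (ecoef (D (e 1))) hn.
suff /subr0_eq -> : D - F = 0 by [].
have derDF : derivation (D - F).
  by apply: derivationD => //; rewrite -scaleN1r; apply/derivationZ/der_span.
apply: (derivation_eq0_coef derDF hn) => [|k hk|k hk];
  by rewrite add_lfunE opp_lfunE ecoefD ecoefN ?F00 ?F0 ?F1 ?subrr.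
Qed.

End Algebra.

Theorem theorem4p19 (R : realType) (n : nat) (hn : (5 <= n)%N)
    (D : 'End('rV[R[i]]_(n.+1))) :
  is_derivation (@IDD_mul R[i] n) D <->
  D \in <<[:: varphi R[i] n;
              phi0 R[i] n; phi1 R[i] n; phi2 R[i] n; phi3 R[i] n; phi4 R[i] n;
              psi0 R[i] n; psi1 R[i] n; psi2 R[i] n]>>%VS.
Proof. exact: derivation_spanP. Qed.
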